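(* Let $n\ge3$ and let $(C_n,\sigma)$ be any signed graph whose underlying graph is the cycle $C_n$ on $n$ vertices. For $k\ge1$ let $m_k$ denote the number of edges (loops included) of $K_k^*$, and let $k_0$ be the largest integer $k$ such that $n\ge m_k$. Then: (i) if $n\ge m_{k_0}+2$, or $n=m_{k_0}+1$ and $K_{k_0}^*$ and $(C_n,\sigma)$ have different balance, or $n=m_{k_0}$ and $K_{k_0}^*$ and $(C_n,\sigma)$ have the same balance, then $\psi(C_n,\sigma)=k_0$; (ii) if $n=m_{k_0}+1$ and $K_{k_0}^*$ and $(C_n,\sigma)$ have the same balance, or $n=m_{k_0}$, $k_0$ is odd, and $K_{k_0}^*$ and $(C_n,\sigma)$ have different balance, then $\psi(C_n,\sigma)=k_0-1$; (iii) otherwise, $\psi(C_n,\sigma)=k_0-2$.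
   Context: A signed graph $(G,\sigma)$ is a finite simple graph $G$ with a signature $\sigma:E(G)\to\{-,+\}$. Switching a set $S\subseteq V(G)$ changes the sign of every edge with exactly one end in $S$; two signed graphs on the same underlying graph are equivalent if one is obtained from the other by switching some set of vertices. The balance of a signed (multi)graph is the parity (even or odd) of its number of negative edges, negative loops included. For $k\ge1$ let $M_k=\{-n,\dots,-1,+1,\dots,+n\}$ if $k=2n$, and $M_k=\{-n,\dots,-1,\pm0,+1,\dots,+n\}$ if $k=2n+1$, where $\pm0$ is a single colour with $-(\pm0)=\pm0$. A $k$-colouring of $(G,\sigma)$ is a map $\phi:V(G)\to M_k$. Let $K_k^*$ be the signed multigraph with vertex set $\{i\ge 0: +i\in M_k\}$ (vertex $0$ standing for colour $\pm0$ when $k$ is odd), in which every two distinct vertices are joined by exactly one positive and one negative edge, and every vertex $i\neq0$ carries exactly one negative loop (so $K_{2p}^*$ has $p^2$ edges and $K_{2p+1}^*$ has $(p+1)^2-1$ edges). Given a $k$-colouring $\phi$, the reduced signed graph $R(G,\sigma,\phi)$ is obtained by (1) switching every vertex with a negative colour $-i$ and recolouring it $+i$; (2) identifying, for each $i$, all vertices of colour $+i$ (resp. $\pm0$) into a single vertex $i$ (resp. $0$), edges inside a class becoming loops; (3) keeping at most one positive and at most one negative edge (or loop) between any two vertices (or at any vertex). The colouring $\phi$ is complete if $R(G,\sigma,\phi)$ is exactly $K_k^*$. The achromatic number $\psi(G,\sigma)$ is the largest $k\ge1$ such that some signed graph equivalent to $(G,\sigma)$ admits a complete $k$-colouring. 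*)

(* Defs.v *)
From mathcomp Require Import all_boot all_order all_algebra.
Set Implicit Arguments.
Unset Strict Implicit.
Unset Printing Implicit Defensive.

(* A sign is a boolean: true is the negative sign, false the positive one. *)
Notation sign := bool (only parsing).

Record graph (T : finType) := Graph {
  edges : {set {set T}};
  edges_card2 : forall e, e \in edges -> #|e| = 2
}.

(* The values of a signature outside the edge set are irrelevant. *)
Record signed_graph (T : finType) := SignedGraph {
  underlying : graph T;
  sgn : {set T} -> sign
}.

Definition switch (T : finType) (S : {set T}) (G : signed_graph T) :
    signed_graph T :=
  SignedGraph (underlying G)
    (fun e => if #|e :&: S| == 1 then ~~ sgn G e else sgn G e).

Definition equivalent (T : finType) (G H : signed_graph T) : Prop :=
  underlying H = underlying G /\
  exists S : {set T},
    forall e, e \in edges (underlying G) -> sgn H e = sgn (switch S G) e.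

(* Signed multigraphs with at most one edge (or loop) of each sign on given
   ends: an edge is the set of its ends (a singleton for a loop) together with
   its sign. *)
Record signed_multigraph (T : finType) := SignedMultigraph {
  mvertices : {set T};
  medges : {set {set T} * sign}
}.

Definition multigraph_of (T : finType) (G : signed_graph T) :
    signed_multigraph T :=
  SignedMultigraph [set: T]
    [set (e, sgn G e) | e in edges (underlying G)].

Definition num_edges (T : finType) (H : signed_multigraph T) : nat :=
  #|medges H|.

(* true is odd balance, false is even balance. *)
Definition balance (T : finType) (H : signed_multigraph T) : bool :=
  odd #|[set f in medges H | f.2]|.

(* The colour set M_k inside int, the colour written +-0 being the integer 0. *)
Definition M (k : nat) : pred int :=
  [pred c : int | (absz c <= k./2)%N && (odd k || (c != 0%R))].

Definition colour (k : nat) := {c : int | M k c}.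

Lemma colour_abs_subproof (k : nat) (c : colour k) :
  absz (val c) < (k./2).+1.
Proof. by case: c => c /= /andP[]. Qed.

Definition colour_abs (k : nat) (c : colour k) : 'I_(k./2).+1 :=
  Ordinal (colour_abs_subproof c).

Definition Kstar_vertices (k : nat) : {set 'I_(k./2).+1} :=
  [set i : 'I_(k./2).+1 | M k (Posz i)].

Definition Kstar (k : nat) : signed_multigraph 'I_(k./2).+1 :=
  SignedMultigraph (Kstar_vertices k)
    ([set f : {set _} * sign | (f.1 \subset Kstar_vertices k) && (#|f.1| == 2)]
     :|: [set ([set i], true) | i in Kstar_vertices k & i != ord0]).

Definition colouring (T : finType) (k : nat) := T -> colour k.

Definition negative_vertices (T : finType) (k : nat) (phi : colouring T k) :
    {set T} :=
  [set v | (val (phi v) < 0)%R].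

(* Edges are sets of (ends, sign) pairs, so taking the image both identifies
   the vertices of each class and removes the parallel edges of equal sign. *)
Definition reduced (T : finType) (k : nat) (G : signed_graph T)
    (phi : colouring T k) : signed_multigraph 'I_(k./2).+1 :=
  let H := multigraph_of (switch (negative_vertices phi) G) in
  let cls v := colour_abs (phi v) in
  SignedMultigraph (cls @: mvertices H)
    [set (cls @: f.1, f.2) | f : {set T} * sign in medges H].

Definition complete (T : finType) (k : nat) (G : signed_graph T)
    (phi : colouring T k) : Prop :=
  reduced G phi = Kstar k.

Definition admits_complete (T : finType) (G : signed_graph T) (k : nat) :
    Prop :=
  exists2 H : signed_graph T, equivalent G H &
  exists phi : colouring T k, complete H phi.

(* psi(G) = k *)
Definition achromatic_number (T : finType) (G : signed_graph T) (k : nat) :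
    Prop :=
  [/\ 1 <= k, admits_complete G k &
      forall j, 1 <= j -> admits_complete G j -> j <= k].

Definition cycle_edges (n : nat) : {set {set 'I_n}} :=
  [set [set i; ordS i] | i : 'I_n].

Lemma cycle_edges_card2 (n : nat) (hn : 3 <= n) (e : {set 'I_n}) :
  e \in cycle_edges n -> #|e| = 2.
Proof.
case/imsetP=> i _ ->; rewrite cards2; case: eqP => // /(congr1 val) /= E.
have := ltn_ord i; rewrite leq_eqVlt => /orP[/eqP h | h].
  by move: E; rewrite h modnn => E; move: h hn; rewrite E => <-.
by move: E; rewrite modn_small // => /eqP; rewrite -[X in X == _]addn0 -addn1 eqn_add2l.
Qed.

Definition cycle_graph (n : nat) (hn : 3 <= n) : graph 'I_n :=
  Graph (@cycle_edges_card2 n hn).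

(* Main.v *)
Require Import Defs.
From mathcomp Require Import all_boot all_order all_algebra zify.
Set Implicit Arguments.
Unset Strict Implicit.
Unset Printing Implicit Defensive.

(* A complete k-colouring of a switching of the signed cycle is a closed walk of
    length n in K_k^* that uses every edge and whose sign is the sign of the
    cycle, since switching lets us realize every signature of the right sign.
    All degrees of K_k^* are even, so an Eulerian closed walk (of length m_k)
    exists. The edges used in excess again have even degrees: one extra edge must
    be a negative loop, while two or more extra edges can have any sign, by
    combining loops with a back-and-forth along a pair of parallel edges. *)

(** * Edges and balance of $K_k^*$ *)

Lemma Kstar_verticesE k (i : 'I_(k./2).+1) :
  (i \in Kstar_vertices k) = odd k || (i != ord0).
Proof. by rewrite inE /M /= -ltnS ltn_ord. Qed.

Lemma card_Kstar_vertices k : #|Kstar_vertices k| = k./2 + odd k.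
Proof.
case: (boolP (odd k)) => ok.
  rewrite addn1 -[RHS]card_ord -cardsT; congr #|pred_of_set _|.
  by apply/setP => i; rewrite Kstar_verticesE ok inE.
rewrite addn0 -[RHS]/((k./2).+1.-1) -[X in X.-1]card_ord -(cardsC1 ord0).
congr #|pred_of_set _|.
by apply/setP => i; rewrite Kstar_verticesE (negbTE ok) !inE.
Qed.

Lemma card_Kstar_loops k :
  #|[set i in Kstar_vertices k | i != ord0]| = k./2.
Proof.
rewrite -[RHS]/((k./2).+1.-1) -[X in X.-1]card_ord -(cardsC1 ord0).
congr #|pred_of_set _|.
by apply/setP => i; rewrite [LHS]inE Kstar_verticesE !inE; case: (i == _); rewrite ?orbT ?andbF.
Qed.

Lemma in_Kstar_medges k (f : {set 'I_(k./2).+1} * bool) :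
  (f \in medges (Kstar k)) =
  (f.1 \subset Kstar_vertices k) && (#|f.1| == 2)
  || [exists i, (i != ord0) && (f == ([set i], true))].
Proof.
rewrite /= inE [f \in finset _]inE; congr (_ || _).
apply/imsetP/existsP => [[i] | [i /andP[i0 /eqP ->]]].
  by rewrite inE => /andP[_ i0] ->; exists i; rewrite i0 eqxx.
by exists i => //; rewrite inE Kstar_verticesE i0 orbT.
Qed.

(** A pair of distinct vertices contributes one edge per sign in [B], while a loop contributes only
    because the negative sign lies in [B]. Taking [B] full gives the number of edges, and [B =
    [set true]] gives the balance. *)
Lemma card_Kstar_signs k (B : {set bool}) :
  true \in B ->
  #|[set f in medges (Kstar k) | f.2 \in B]|
  = 'C(k./2 + odd k, 2) * #|B| + k./2.
Proof.
move=> Bt; rewrite -card_Kstar_vertices -cards_draws -cardsX.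
rewrite -[X in _ = _ + X](card_Kstar_loops k).
rewrite -(@card_imset _ _ (fun i : 'I_(k./2).+1 => ([set i], true))); last first.
  by move=> i j [] /set1_inj.
set L := imset _ _; set A := setX _ _.
have -> : [set f in medges (Kstar k) | f.2 \in B] = A :|: L.
  apply/setP => [[e b]]; rewrite 2!inE /= [RHS]inE in_setX /= !inE andb_orl.
  congr (_ || _); apply/andP/idP => [[]// | eL]; split => //.
  by case/imsetP: eL => i _ [_ ->].
rewrite cardsU (_ : A :&: L = set0) ?cards0 ?subn0 //.
apply/setP => [[e b]]; rewrite !inE /= ; apply/negbTE/negP.
case/andP=> /andP[/andP[_ e2] _] /imsetP[i _ [ei _]].
by rewrite ei cards1 in e2.
Qed.

Lemma num_edges_Kstar k :
  num_edges (Kstar k) = 'C(k./2 + odd k, 2) * 2 + k./2.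
Proof.
have := @card_Kstar_signs k setT (in_setT _); rewrite cardsT card_bool => <-.
by rewrite /num_edges; congr #|pred_of_set _|; apply/setP => f; rewrite !inE andbT.
Qed.

Lemma balance_Kstar k :
  balance (Kstar k) = odd ('C(k./2 + odd k, 2) + k./2).
Proof.
have := @card_Kstar_signs k [set true] (set11 _); rewrite cards1 muln1 => <-.
rewrite /balance; congr (odd #|pred_of_set _|).
by apply/setP => f; rewrite [LHS]inE [RHS]inE in_set1 eqb_id.
Qed.


(** * Sums modulo 2 along injective and almost injective maps *)

Lemma odd_card_set (T : finType) (A : {set T}) (P : pred T) :
  odd #|[set x in A | P x]| = \big[addb/false]_(x in A) P x.
Proof.
rewrite -sum1_card (big_morph odd oddD (erefl _)) [RHS]big_mkcond.
by rewrite [LHS]big_mkcond; apply: eq_bigr => x _; rewrite inE; case: (x \in A); case: (P x).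
Qed.

Lemma big_addb_onto (I T : finType) (g : I -> T) (h : T -> bool) :
  #|I| = #|[set g i | i : I]| ->
  \big[addb/false]_i h (g i) = \big[addb/false]_(x in [set g i | i : I]) h x.
Proof.
by move=> cI; rewrite big_imset //=; apply/imset_injP; rewrite -cI.
Qed.

Lemma big_addb_onto_succ (I T : finType) (g : I -> T) :
  #|I| = #|[set g i | i : I]| + 1 ->
  exists i0, forall h : T -> bool,
    \big[addb/false]_i h (g i)
    = h (g i0) (+) \big[addb/false]_(x in [set g i | i : I]) h x.
Proof.
move=> cI; have /injectivePn[i0 [i1 i01 g01]] : ~~ injectiveb g.
  apply/negP => /injectiveP gi.
  by have := card_imset I gi; rewrite cI => /eqP; rewrite -[X in X == _]addn0 eqn_add2l.
(* Dropping [i0] does not shrink the image, since [i1] takes the same value; by cardinality [g] is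
   then injective on the remaining indices. *)
have gE : [set g i | i : I] = g @: [set~ i0].
  apply/eqP; rewrite eqEsubset andbC imsetS ?subset_predT //=.
  apply/subsetP => _ /imsetP[i _ ->]; case: (eqVneq i i0) => [->|ne].
    by rewrite g01 imset_f // !inE eq_sym.
  by rewrite imset_f // !inE.
exists i0 => h; rewrite (bigD1 i0) //= gE big_imset /=; last first.
  by apply/imset_injP; rewrite -gE cardsC1 cI addn1.
by congr (_ (+) _); apply: eq_bigl => i; rewrite !inE.
Qed.

(** * Signs and switching on the cycle *)

Section Cycle.
Variables (n : nat) (hn : 3 <= n).
Implicit Types (sigma : {set 'I_n} -> bool) (i j : 'I_n).

Definition cedge i : {set 'I_n} := [set i; ordS i].

Lemma ordS_neq i : i != ordS i.
Proof.
have := @cycle_edges_card2 n hn (cedge i) (imset_f _ (isT : i \in 'I_n)).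
by rewrite cards2; case: (i != _).
Qed.

Lemma ordS_ordS_neq i : i != ordS (ordS i).
Proof.
apply/eqP => /(congr1 val) /=; have := ltn_ord i => lt_in.
case: (ltngtP i.+1 n) => [h|h|h]; first 1 last.
- lia.
- rewrite h modnn modn_small; lia.
- rewrite (modn_small h); case: (ltngtP i.+2 n) => h'; first 1 last.
  + lia.
  + rewrite h' modnn; lia.
  + rewrite modn_small; lia.
Qed.

(** Two distinct indices with the same edge would be successors of each other, which [ordS_ordS_neq]
    excludes for $n\ge3$. *)
Lemma cedge_inj : injective cedge.
Proof.
move=> i j /setP eij; have := eij i; rewrite !inE eqxx /= => /esym.
case: eqP => //= _ /eqP ei; have := eij j; rewrite !inE eqxx /=.
case: eqP => //= _ /eqP ej; move: (ordS_ordS_neq i).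
by rewrite -ej -ei eqxx.
Qed.

Definition cycle_sign sigma := \big[addb/false]_i sigma (cedge i).

Lemma balance_cycle sigma :
  balance (multigraph_of (SignedGraph (cycle_graph hn) sigma))
  = cycle_sign sigma.
Proof.
rewrite /balance odd_card_set /= big_imset /=; last by move=> e f _ _ [].
by rewrite big_imset //= => i j _ _; apply: cedge_inj.
Qed.

Lemma sgn_switch_cedge (S : {set 'I_n}) (G : signed_graph 'I_n) i :
  sgn (switch S G) (cedge i)
  = sgn G (cedge i) (+) ((i \in S) (+) (ordS i \in S)).
Proof.
rewrite /= /cedge setIUl cardsU.
have dE : [set i] :&: S :&: ([set ordS i] :&: S) = set0.
  apply/setP => j; rewrite !inE; apply/negbTE/negP.
  by case/andP=> /andP[/eqP-> _] /andP[/eqP eiS _]; have := ordS_neq i; rewrite -eiS eqxx.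
rewrite dE cards0 subn0.
have c1 j : #|[set j] :&: S| = (j \in S).
  case: (boolP (j \in S)) => jS; first by rewrite (setIidPl _) ?cards1 ?sub1set.
  by apply/eqP; rewrite cards_eq0 setI_eq0 disjoints1.
rewrite !c1; by case: (i \in S); case: (ordS i \in S); case: (sgn G _).
Qed.

(** Each vertex is counted twice, once from each of its two edges. This one cancellation gives both
    the invariance of the cycle sign under switching and the evenness of degrees along closed
    walks. *)
Lemma big_addb_ordS (P : pred 'I_n) :
  \big[addb/false]_i (P i (+) P (ordS i)) = false.
Proof.
rewrite big_split /= [X in X (+) _](reindex_inj (can_inj (@ordSK n))).
exact: addbb.
Qed.

Lemma cycle_sign_switch (S : {set 'I_n}) (G : signed_graph 'I_n) :
  cycle_sign (sgn (switch S G)) = cycle_sign (sgn G).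
Proof.
rewrite /cycle_sign (eq_bigr _ (fun i _ => sgn_switch_cedge S G i)) big_split /=.
by rewrite (big_addb_ordS (fun i => i \in S)) addbF.
Qed.

(* Switch the vertices [i] such that [s] and [sigma] differ on an odd number of
   the edges before [i]; the hypothesis makes this consistent around the cycle. *)
Lemma switch_of_cycle_sign sigma (s : 'I_n -> bool) :
  \big[addb/false]_i s i = cycle_sign sigma ->
  exists S : {set 'I_n}, forall i,
    s i = sgn (switch S (SignedGraph (cycle_graph hn) sigma)) (cedge i).
Proof.
move=> sE; pose d i := s i (+) sigma (cedge i).
pose D m := \big[addb/false]_(i : 'I_n | i < m) d i.
exists [set i : 'I_n | D i] => i; rewrite sgn_switch_cedge /= !inE /=.
have Dn : D n = false.
  rewrite /D (eq_bigl xpredT) ?big_split /= ?sE ?addbb //.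
  by move=> j; rewrite ltn_ord.
have D0 : D 0 = false by rewrite /D big_pred0.
have DS : D i.+1 = D i (+) d i.
  rewrite /D (bigD1 i) //= addbC; congr (_ (+) _); apply: eq_bigl => j.
  by rewrite ltnS andbC -(inj_eq val_inj) ltn_neqAle.
have -> : D (i.+1 %% n) = D i.+1.
  case: (ltngtP i.+1 n) => h; first by rewrite modn_small.
    by have := ltn_ord i; lia.
  by rewrite h modnn D0 Dn.
by rewrite DS addKb /d addbC addbK.
Qed.


(** * Complete colourings as closed walks covering $K_k^*$ *)

Definition walk_edge (V : finType) (w : 'I_n -> V) (s : 'I_n -> bool) i :
  {set V} * bool := ([set w i; w (ordS i)], s i).

(** Closedness is built in: the last step returns to [w] at index 0 because [ordS] wraps around. A
    step with equal ends has a singleton as its set of ends, which is how loops are encoded. *)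
Definition covering_walk k (w : 'I_n -> 'I_(k./2).+1) (s : 'I_n -> bool) :=
  [set walk_edge w s i | i : 'I_n] = medges (Kstar k).

Lemma medges_reduced k (H : signed_graph 'I_n) (phi : colouring 'I_n k) :
  underlying H = cycle_graph hn ->
  medges (reduced H phi)
  = [set walk_edge (fun v => colour_abs (phi v))
       (fun v => sgn (switch (negative_vertices phi) H) (cedge v)) i
    | i : 'I_n].
Proof.
move=> uH; rewrite /reduced /= uH /= -!imset_comp; apply: eq_imset => i /=.
by rewrite /walk_edge imsetU !imset_set1.
Qed.

Lemma walk_edge_sub k w s i :
  covering_walk (k := k) w s -> [set w i; w (ordS i)] \subset Kstar_vertices k.
Proof.
move=> ws; have := imset_f (walk_edge w s) (isT : i \in 'I_n); rewrite ws.
rewrite in_Kstar_medges => /orP[/andP[]// | /existsP[a /andP[a0 /eqP[]]] -> _].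
by rewrite sub1set Kstar_verticesE a0 orbT.
Qed.

Lemma covering_walk_of_admits sigma k :
  admits_complete (SignedGraph (cycle_graph hn) sigma) k ->
  exists w s,
    covering_walk (k := k) w s /\ \big[addb/false]_i s i = cycle_sign sigma.
Proof.
case=> H [/= uH [S HS]] [phi ph].
exists (fun v => colour_abs (phi v)).
exists (fun v => sgn (switch (negative_vertices phi) H) (cedge v)); split.
  by rewrite /covering_walk -ph medges_reduced.
rewrite -[LHS]/(cycle_sign _) cycle_sign_switch.
rewrite -(cycle_sign_switch S (SignedGraph (cycle_graph hn) sigma)).
by apply: eq_bigr => i _; rewrite HS // imset_f.
Qed.

(** The walk is read as a colouring with nonnegative colours, so that the reduction switches
    nothing; the prescribed signs are obtained by switching the cycle beforehand. *)
Lemma admits_of_covering_walk sigma k w s : 1 < k ->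
  covering_walk (k := k) w s -> \big[addb/false]_i s i = cycle_sign sigma ->
  admits_complete (SignedGraph (cycle_graph hn) sigma) k.
Proof.
move=> k1 ws sE; have [S HS] := switch_of_cycle_sign sE.
have wV i : w i \in Kstar_vertices k.
  by apply: (subsetP (walk_edge_sub i ws)); rewrite !inE eqxx.
have wM i : M k (Posz (w i)) by have := wV i; rewrite inE.
pose phi : colouring 'I_n k := fun i => exist _ (Posz (w i)) (wM i).
have phiE i : colour_abs (phi i) = w i by apply: val_inj.
exists (switch S (SignedGraph (cycle_graph hn) sigma)); first by split; last exists S.
exists phi; rewrite /complete.
have N0 : negative_vertices phi = set0 by apply/setP => i; rewrite !inE.
have eE : medges (reduced (switch S (SignedGraph (cycle_graph hn) sigma)) phi)
          = medges (Kstar k).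
  rewrite medges_reduced // -ws; apply: eq_imset => i.
  by rewrite /walk_edge !phiE HS (sgn_switch_cedge _ (switch _ _)) N0 !inE !addbF.
have vE : mvertices (reduced (switch S (SignedGraph (cycle_graph hn) sigma)) phi)
          = Kstar_vertices k.
  apply/setP => a; apply/imsetP/idP => [[i _ ->] | aV]; first by rewrite phiE.
  (* Every vertex lies on some edge and is therefore visited: a nonzero vertex lies on its loop, and
     vertex 0 on an edge to [ord_max], which is different from 0 because $k>1$. *)
  have [e ae eK] : exists2 e : {set 'I_(k./2).+1} * bool, a \in e.1 & e \in medges (Kstar k).
    case: (eqVneq a ord0) => a0; last first.
      exists ([set a], true); first by rewrite inE.
      rewrite in_Kstar_medges; apply/orP; right; apply/existsP; exists a.
      by rewrite a0 eqxx.
    have ok : odd k by rewrite a0 Kstar_verticesE eqxx orbF in aV.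
    exists ([set a; ord_max], true); first by rewrite !inE eqxx.
    rewrite in_Kstar_medges /= cards2 a0 subUset !sub1set !Kstar_verticesE ok /=.
    by rewrite -(inj_eq val_inj) /=; case: k k1 {w s ws sE HS wV wM phi phiE N0 eE aV a a0 ok} => [|[|]].
  move: eK; rewrite -ws => /imsetP[i _ eE']; move: ae; rewrite eE' !inE.
  by case/orP=> /eqP->; [exists i | exists (ordS i)]; rewrite ?phiE ?inE.
move: eE vE; rewrite /= => eE vE; rewrite /reduced /Kstar /=.
by congr SignedMultigraph.
Qed.

(** * Constraints on the length and sign of a covering walk *)

Section Upper.
Variables (k : nat) (w : 'I_n -> 'I_(k./2).+1) (s : 'I_n -> bool).
Hypothesis ws : covering_walk w s.

Lemma covering_walk_size : num_edges (Kstar k) <= n.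
Proof. by rewrite /num_edges -ws -[X in _ <= X]card_ord leq_imset_card. Qed.

(** With as many steps as edges, each edge is used exactly once. *)
Lemma covering_walk_tight :
  n = num_edges (Kstar k) -> \big[addb/false]_i s i = balance (Kstar k).
Proof.
rewrite /num_edges /balance -ws odd_card_set => nm.
by rewrite -big_addb_onto // card_ord.
Qed.

(** Non-loop edges come in parallel pairs of opposite sign. *)
Lemma Kstar_nonloop_degree_even a :
  \big[addb/false]_(f in medges (Kstar k)) ((a \in f.1) && (#|f.1| == 2))
  = false.
Proof.
rewrite -odd_card_set.
pose A := [set e : {set 'I_(k./2).+1} | [&& e \subset Kstar_vertices k, #|e| == 2 & a \in e]].
rewrite (_ : [set _ in _ | _] = setX A setT).
  by rewrite cardsX cardsT card_bool muln2 odd_double.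
apply/setP => [[e b]]; rewrite [LHS]inE in_Kstar_medges in_setX !inE andbT /=.
case e2 : (#|e| == 2); rewrite ?andbF ?andbT //=.
case: existsP => [[i /andP[_ /eqP[ei _]]] | _]; last by rewrite orbF.
by rewrite ei cards1 in e2.
Qed.

(* Only one edge is used twice; since all non-loop degrees are even in a closed
   walk and in [Kstar k], this edge is a (negative) loop. *)
Lemma covering_walk_tight_succ :
  n = num_edges (Kstar k) + 1 ->
  \big[addb/false]_i s i = ~~ balance (Kstar k).
Proof.
rewrite /num_edges -ws -[X in X = _]card_ord => nm.
have [i0 Hi0] := big_addb_onto_succ nm.
rewrite /balance odd_card_set -ws [LHS](Hi0 snd).
suff -> : (walk_edge w s i0).2 by [].
have := imset_f (walk_edge w s) (isT : i0 \in 'I_n).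
rewrite ws in_Kstar_medges => /orP[|/existsP[a /andP[_ /eqP->]]//].
case/andP=> _ e2.
(* Suppose that the repeated edge is not a loop, and count modulo 2 the non-loop steps at its end
   [w i0]: the edges of $K_k^*$ contribute 0 and the repetition contributes 1. *)
have := Hi0 (fun f => (w i0 \in f.1) && (#|f.1| == 2)).
rewrite ws Kstar_nonloop_degree_even addbF e2 /= !inE eqxx /=.
(* A step is a non-loop at [w i0] exactly when one of its two ends is [w i0], so the same count
   telescopes to 0 around the closed walk, a contradiction. *)
rewrite (eq_bigr (fun i => (w i == w i0) (+) (w (ordS i) == w i0))).
  by rewrite (big_addb_ordS (fun i => w i == w i0)).
move=> i _; rewrite cards2 !inE !(eq_sym (w i0)).
case: (eqVneq (w i)) => [->|ne]; first by rewrite eq_sym; case: eqP.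
by case: (eqVneq (w (ordS i))) => [->|ne'] //=; rewrite ne.
Qed.

End Upper.

End Cycle.

(** * Closed trails through all pairs of a vertex list *)

Section Trail.
Variable V : finType.
Implicit Types (u v x y : V) (l : seq (V * bool)).

(* A trail from [u] is the list of its steps: the vertex reached and the sign of
   the edge taken. *)
Fixpoint trail_edges u l : seq ({set V} * bool) :=
  if l is (v, b) :: l' then ([set u; v], b) :: trail_edges v l' else [::].

Definition trail_end u l := last u (unzip1 l).

Lemma size_trail_edges u l : size (trail_edges u l) = size l.
Proof. by elim: l u => [|[v b] l IH] u //=; rewrite IH. Qed.

Lemma trail_end_cat u l1 l2 :
  trail_end u (l1 ++ l2) = trail_end (trail_end u l1) l2.
Proof. by rewrite /trail_end /unzip1 map_cat last_cat. Qed.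

Lemma trail_edges_cat u l1 l2 :
  trail_edges u (l1 ++ l2)
  = trail_edges u l1 ++ trail_edges (trail_end u l1) l2.
Proof. by elim: l1 u => [|[v b] l IH] u //=; rewrite IH. Qed.

Lemma nth_trail_edges f0 u l i : i < size l ->
  nth f0 (trail_edges u l) i
  = ([set nth u (u :: unzip1 l) i; nth u (unzip1 l) i], nth false (unzip2 l) i).
Proof.
elim: l u i => [|[v b] l IH] u [|i] //= ilt; rewrite IH //.
by congr ([set _; _], _); apply: set_nth_default; rewrite /= ?size_map // ltnW.
Qed.

Lemma trail_edges_sign u l :
  \big[addb/false]_(f <- trail_edges u l) f.2 = \big[addb/false]_(a <- l) a.2.
Proof. by elim: l u => [|[v b] l IH] u; rewrite ?big_nil //= !big_cons IH. Qed.

(** Each detour goes out along the positive edge and back along the negative one, using up both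
    parallel edges. *)
Definition detours u (r : seq V) :=
  flatten [seq [:: (x, false); (u, true)] | x <- r].

Lemma trail_end_detours u r : trail_end u (detours u r) = u.
Proof. by elim: r. Qed.

Lemma size_detours u r : size (detours u r) = (size r).*2.
Proof. by elim: r => //= x r ->. Qed.

Lemma mem_detours u r x b :
  x \in r -> ([set u; x], b) \in trail_edges u (detours u r).
Proof.
elim: r => //= y r IH; rewrite !inE => /predU1P[-> | /IH->]; last by rewrite !orbT.
by case: b {IH}; rewrite ?[[set y; u]]setUC eqxx ?orbT.
Qed.

(** Marks the vertices carrying a loop; coerced to 0 or 1, it is the number of loop steps made at a
    vertex. *)
Variable lp : pred V.

(* Enter the next vertex [v] by the positive edge, traverse the closed trail on
   the remaining vertices, come back by the negative edge, and make a detour to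
   each vertex after [v]. *)
Fixpoint euler u us : seq (V * bool) :=
  nseq (lp u) (u, true) ++
  if us is v :: r then (v, false) :: euler v r ++ (u, true) :: detours u r
  else [::].

Lemma trail_end_loops u t : trail_end u (nseq t (u, true)) = u.
Proof. by elim: t. Qed.

Lemma trail_end_euler u us : trail_end u (euler u us) = u.
Proof.
case: us => [|v r] /=; rewrite trail_end_cat trail_end_loops //.
rewrite -cat_cons trail_end_cat -cat1s trail_end_cat.
exact: trail_end_detours.
Qed.

Lemma trail_edges_euler_cons u v r :
  trail_edges u (euler u (v :: r))
  = trail_edges u (nseq (lp u) (u, true))
    ++ ([set u; v], false) :: trail_edges v (euler v r)
    ++ ([set v; u], true) :: trail_edges u (detours u r).
Proof.
by rewrite /= trail_edges_cat trail_end_loops /= trail_edges_cat trail_end_euler.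
Qed.

Lemma size_euler u us :
  size (euler u us) = count lp (u :: us) + (size us).+1 * size us.
Proof.
elim: us u => [|v r IH] u /=; first by rewrite cats0 size_nseq muln0 !addn0.
rewrite size_cat size_nseq /= size_cat /= IH size_detours /=; lia.
Qed.

Lemma mem_euler_loop u us x :
  lp x -> x \in u :: us -> ([set x], true) \in trail_edges u (euler u us).
Proof.
move=> lx; have lE v : lp v -> ([set v], true) \in trail_edges v (nseq (lp v) (v, true)).
  by move=> ->; rewrite inE setUid.
elim: us u => [|v r IH] u.
  by rewrite !inE => /eqP<-; rewrite -[euler _ _]/(nseq _ _ ++ [::]) cats0; apply: lE.
rewrite inE trail_edges_euler_cons mem_cat => /predU1P[<- | xr]; first by rewrite lE.
by rewrite inE mem_cat IH ?orbT.
Qed.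

Lemma mem_euler_pair u us x y b :
  x != y -> x \in u :: us -> y \in u :: us ->
  ([set x; y], b) \in trail_edges u (euler u us).
Proof.
(* Pairs containing the start vertex: the first neighbour is served by the entering and returning
   edges, the others by detours. All remaining pairs belong to the inner trail. *)
have hub w z v r :
    z \in v :: r -> ([set w; z], b) \in trail_edges w (euler w (v :: r)).
  move=> zvr; rewrite trail_edges_euler_cons mem_cat inE mem_cat inE.
  move: zvr; rewrite inE.
  case/predU1P=> [-> | zr]; last by rewrite mem_detours // !orbT.
  by case: b; rewrite ?[[set v; w]]setUC eqxx !orbT.
move=> xy; elim: us u => [|v r IH] u.
  by rewrite !inE => /eqP xu /eqP yu; rewrite xu yu eqxx in xy.
rewrite ![_ \in u :: _]inE; case/predU1P=> [xu | xr]; case/predU1P=> [yu | yr].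
- by rewrite xu yu eqxx in xy.
- by rewrite xu hub.
- by rewrite yu setUC hub.
- by rewrite trail_edges_euler_cons mem_cat inE mem_cat IH ?orbT.
Qed.

End Trail.

(** * An Eulerian closed trail of $K_k^*$ *)

Definition hub k : 'I_(k./2).+1 := ord_max.

Definition Kstar_euler k :=
  euler (fun i => i != ord0) (hub k) (enum (Kstar_vertices k :\ hub k)).

(** The base vertex must be nonzero so that it carries a negative loop, which can be repeated to
    lengthen a walk. *)
Lemma hub_neq0 k : 1 < k -> hub k != ord0.
Proof. by case: k => [|[|]]. Qed.

Lemma perm_hub k : 1 < k ->
  perm_eq (hub k :: enum (Kstar_vertices k :\ hub k)) (enum (Kstar_vertices k)).
Proof.
move=> k1; apply: uniq_perm; rewrite /= ?enum_uniq ?mem_enum ?setD11 // => i.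
rewrite inE !mem_enum in_setD1; case: eqVneq => // ->.
by rewrite Kstar_verticesE hub_neq0 ?orbT.
Qed.

Lemma size_Kstar_euler k : 1 < k -> size (Kstar_euler k) = num_edges (Kstar k).
Proof.
move=> k1; have ph := perm_hub k1; rewrite size_euler num_edges_Kstar.
have -> : (size (enum (Kstar_vertices k :\ hub k))) = (k./2 + odd k).-1.
  by rewrite -card_Kstar_vertices cardE -(perm_size ph).
rewrite (permP ph) -sum1_count big_enum_cond /= sum1dep_card card_Kstar_loops.
rewrite addnC; congr (_ + _).
(* Uses $2\binom N2=N(N-1)$ with $N$ the number of vertices of $K_k^*$. *)
have := bin_ffact (k./2 + odd k) 2; rewrite ffactnS ffactn1 [2`!]/= => ->.
by case: (k./2 + odd k) (hub_neq0 k1) => // ; case: k k1 {ph} => [|[|]].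
Qed.

(** The trail contains every edge and has no more steps than there are edges, so it runs through
    each edge exactly once. *)
Lemma perm_Kstar_euler k : 1 < k ->
  perm_eq (trail_edges (hub k) (Kstar_euler k)) (enum (medges (Kstar k))).
Proof.
move=> k1; have ph := perm_hub k1.
have mh i : (i \in hub k :: enum (Kstar_vertices k :\ hub k)) = (i \in Kstar_vertices k).
  by rewrite (perm_mem ph) mem_enum.
have sz : size (trail_edges (hub k) (Kstar_euler k)) <= size (enum (medges (Kstar k))).
  by rewrite size_trail_edges size_Kstar_euler // -cardE.
have sub : {subset enum (medges (Kstar k)) <= trail_edges (hub k) (Kstar_euler k)}.
  move=> [e b]; rewrite mem_enum in_Kstar_medges /= => /orP[|/existsP[i]].
    case/andP=> + /cards2P[x [y [xy eE]]].
    rewrite eE subUset !sub1set => /andP[xV yV].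
    by apply: mem_euler_pair; rewrite ?mh.
  case/andP=> i0 /eqP[-> ->]; apply: mem_euler_loop => //.
  by rewrite mh Kstar_verticesE i0 orbT.
have [_ eqm] := uniq_min_size (enum_uniq _) sub sz.
rewrite perm_sym; apply: uniq_perm => //; first exact: enum_uniq.
exact: leq_size_uniq (enum_uniq _) sub sz.
Qed.

(** * Colourings built by lengthening the Eulerian trail *)

Lemma admits_of_trail n (hn : 3 <= n) (sigma : {set 'I_n} -> bool) k u l :
  1 < k -> size l = n -> trail_end u l = u ->
  trail_edges u l =i medges (Kstar k) ->
  \big[addb/false]_(a <- l) a.2 = cycle_sign sigma ->
  admits_complete (SignedGraph (cycle_graph hn) sigma) k.
Proof.
move=> k1 sl el ml sgl.
pose w (i : 'I_n) := nth u (u :: unzip1 l) i.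
pose s (i : 'I_n) := nth false (unzip2 l) i.
have wS i : w (ordS i) = nth u (unzip1 l) i.
  rewrite /w /=; case: (ltngtP i.+1 n) => h; first by rewrite modn_small.
    by have := ltn_ord i; lia.
  (* At the last index the successor wraps to 0, where [w] is the start [u]; it agrees with the last
     vertex reached because the trail is closed. *)
  by rewrite h modnn /= -{1}el /trail_end -nth_last size_map sl -[X in X.-1]h.
have eE f0 (i : 'I_n) : walk_edge w s i = nth f0 (trail_edges u l) i.
  by rewrite nth_trail_edges ?sl // /walk_edge wS.
apply: (@admits_of_covering_walk n hn sigma k w s) => //; last first.
  by rewrite -sgl -(big_map snd xpredT id) (big_nth false) size_map sl big_mkord.
apply/setP => f; rewrite -ml; apply/imsetP/idP => [[i _ ->] | fl].
  by rewrite (eE (set0, true)) mem_nth // size_trail_edges sl.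
have fi : index f (trail_edges u l) < n by rewrite -sl -(size_trail_edges u) index_mem.
by exists (Ordinal fi) => //; rewrite (eE (set0, true)) nth_index.
Qed.

Section Lower.
Variables (n : nat) (hn : 3 <= n) (sigma : {set 'I_n} -> bool) (k : nat).
Hypothesis k1 : 1 < k.
Local Notation admits :=
  (admits_complete (SignedGraph (cycle_graph hn) sigma) k).

(** A closed trail [x] at the hub inside $K_k^*$ can be prepended to the Eulerian one: coverage is
    preserved, and lengths and signs add up. *)
Lemma admits_extend x :
  trail_end (hub k) x = hub k ->
  {subset trail_edges (hub k) x <= medges (Kstar k)} ->
  n = num_edges (Kstar k) + size x ->
  \big[addb/false]_(a <- x) a.2 = balance (Kstar k) (+) cycle_sign sigma ->
  admits.
Proof.
move=> ex mx nx sx; have pe := perm_Kstar_euler k1.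
apply: (@admits_of_trail n hn sigma k (hub k) (x ++ Kstar_euler k)) => //.
- by rewrite size_cat size_Kstar_euler // nx addnC.
- by rewrite trail_end_cat ex trail_end_euler.
- move=> f; rewrite trail_edges_cat ex mem_cat (perm_mem pe) mem_enum.
  by case: (boolP (f \in trail_edges _ _)) => // /mx ->.
- rewrite big_cat /= sx -(trail_edges_sign (hub k)) (perm_big _ pe) /=.
  by rewrite big_enum -odd_card_set addbC addKb.
Qed.

Lemma trail_edges_hub_loops t :
  {subset trail_edges (hub k) (nseq t (hub k, true)) <= medges (Kstar k)}.
Proof.
elim: t => //= t IH f; rewrite inE setUid => /predU1P[-> | /IH //].
rewrite in_Kstar_medges; apply/orP; right; apply/existsP; exists (hub k).
by rewrite hub_neq0 /=.
Qed.

Lemma big_addb_loops t :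
  \big[addb/false]_(a <- nseq t (hub k, true)) a.2 = odd t.
Proof. by elim: t => [|t IH]; rewrite ?big_nil //= big_cons IH. Qed.

Lemma admits_loops t :
  n = num_edges (Kstar k) + t ->
  odd t = balance (Kstar k) (+) cycle_sign sigma -> admits.
Proof.
move=> nt st; apply: (admits_extend (x := nseq t (hub k, true))).
- exact: trail_end_loops.
- exact: trail_edges_hub_loops.
- by rewrite size_nseq.
- by rewrite big_addb_loops.
Qed.

(** An excess of [t.+2] steps is filled either by [t.+2] negative loops, or by [t] loops and one
    back-and-forth along parallel edges. The two fillings have opposite signs, so one of them fits.
    The second needs another vertex besides the hub, whence $k>2$. *)
Lemma admits_slack : 2 < k -> num_edges (Kstar k) + 2 <= n -> admits.
Proof.
move=> k2 le_n; pose t := n - (num_edges (Kstar k) + 2).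
have nE : n = num_edges (Kstar k) + t.+2 by rewrite /t; lia.
case: (eqVneq (odd t) (balance (Kstar k) (+) cycle_sign sigma)) => [ot|ot].
  by apply: (admits_loops nE); rewrite /= negbK.
(* The vertex just below the hub: it is 0 only for $k=3$, and since 3 is odd it is then still a
   vertex of $K_k^*$. *)
pose v : 'I_(k./2).+1 := inord (k./2).-1.
have vE : v = (k./2).-1 :> nat by rewrite inordK // ltnS leq_pred.
have half_k := odd_double_half k.
have vhub : v != hub k by rewrite -(inj_eq val_inj) /= vE; lia.
have vV : v \in Kstar_vertices k.
  by rewrite Kstar_verticesE -(inj_eq val_inj) /= vE; case: (odd k) half_k => //=; lia.
have hV : hub k \in Kstar_vertices k by rewrite Kstar_verticesE hub_neq0 ?orbT.
apply: (admits_extend (x := nseq t (hub k, true) ++ [:: (v, false); (hub k, true)])).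
- by rewrite trail_end_cat.
- move=> f; rewrite trail_edges_cat mem_cat => /orP[/trail_edges_hub_loops //|].
  rewrite trail_end_loops /= in_cons mem_seq1 [[set v; _]]setUC => /orP[] /eqP->;
  by rewrite in_Kstar_medges /= cards2 subUset !sub1set hV vV (eq_sym (hub k)) vhub.
- by rewrite size_cat size_nseq addn2.
- by rewrite big_cat /= big_addb_loops !big_cons big_nil /=; move: ot; case: (odd t); case: (_ (+) _).
Qed.

End Lower.

(** * Edge counts and balances by the parity of $k$ *)

Lemma num_edges_Kstar_even p : num_edges (Kstar p.*2) = p * p.
Proof.
rewrite num_edges_Kstar odd_double doubleK addn0.
by have := bin_ffact p 2; rewrite ffactnS ffactn1 [2`!]/= => ->; case: p => //= p; lia.
Qed.

Lemma num_edges_Kstar_odd p : num_edges (Kstar p.*2.+1) = p * p + p.*2.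
Proof.
rewrite num_edges_Kstar /= odd_double uphalf_double addn1.
by have := bin_ffact p.+1 2; rewrite ffactnS ffactn1 [2`!]/= => ->; lia.
Qed.

(** Both graphs have $p+1$ vertices, and the even one has exactly one more negative loop. *)
Lemma balance_Kstar_even_pred p :
  balance (Kstar p.+1.*2) = ~~ balance (Kstar p.*2.+1).
Proof.
rewrite !balance_Kstar odd_double doubleK /= odd_double uphalf_double addn0 addn1.
by rewrite addnS.
Qed.

(** * Necessary conditions for a complete colouring of the cycle *)

Section Bounds.
Variables (n : nat) (hn : 3 <= n) (sigma : {set 'I_n} -> bool).
Local Notation C := (SignedGraph (cycle_graph hn) sigma).

Lemma admits_size k : admits_complete C k -> num_edges (Kstar k) <= n.
Proof. by case/covering_walk_of_admits=> w [s [/covering_walk_size]]. Qed.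

Lemma admits_tight k : admits_complete C k -> n = num_edges (Kstar k) ->
  balance (Kstar k) = cycle_sign sigma.
Proof. by case/covering_walk_of_admits=> w [s [/covering_walk_tight ws <-]] /ws. Qed.

Lemma admits_tight_succ k : admits_complete C k ->
  n = num_edges (Kstar k) + 1 -> balance (Kstar k) = ~~ cycle_sign sigma.
Proof.
case/covering_walk_of_admits=> w [s [ws <-]] /(covering_walk_tight_succ ws) ->.
by rewrite negbK.
Qed.

End Bounds.

(** * The three cases of the achromatic number *)

Theorem theorem2p15 (n : nat) (hn : 3 <= n) (sigma : {set 'I_n} -> sign)
    (k0 : nat) (hk0 : 1 <= k0)
    (hk0n : num_edges (Kstar k0) <= n)
    (hk0max : forall k, 1 <= k -> num_edges (Kstar k) <= n -> k <= k0) :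
  let C := SignedGraph (cycle_graph hn) sigma in
  let m := num_edges (Kstar k0) in
  let same_balance := balance (Kstar k0) = balance (multigraph_of C) in
  let case_i :=
    [\/ m + 2 <= n,
        n = m + 1 /\ ~ same_balance |
        n = m /\ same_balance] in
  let case_ii :=
    (n = m + 1 /\ same_balance) \/ [/\ n = m, odd k0 & ~ same_balance] in
  [/\ case_i -> achromatic_number C k0,
      case_ii -> achromatic_number C (k0 - 1) &
      ~ case_i -> ~ case_ii -> achromatic_number C (k0 - 2)].
Proof.
move=> C m; rewrite balance_cycle /=; pose sb := balance (Kstar k0) = cycle_sign sigma.
rewrite -/sb.
(* $K_3^*$ has 3 edges and $n\ge3$. *)
have k3 : 3 <= k0 by apply: hk0max => //; rewrite (num_edges_Kstar_odd 1).
have b2 : balance (Kstar 2) = true by rewrite balance_Kstar.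
have le_k0 j : 1 <= j -> admits_complete C j -> j <= k0.
  by move=> j1 /admits_size; apply: hk0max.
have sbP : ~ sb -> balance (Kstar k0) = ~~ cycle_sign sigma.
  by rewrite /sb; case: (balance _); case: (cycle_sign _).
have not_k0 : n = m /\ ~ sb \/ n = m + 1 /\ sb -> ~ admits_complete C k0.
  case=> [[nm nsb] | [nm sb']] ad; first exact/nsb/admits_tight.
  have := admits_tight_succ ad nm; rewrite [LHS]sb'.
  by case: (cycle_sign _).
split.
- move=> Ci; split; [by [] | | exact: le_k0]; case: Ci => [le_n | [nm] | [nm sb']].
  + exact: (admits_slack _ _ (ltnW k3)).
  + move/sbP=> bE; apply: (admits_loops hn (ltnW k3) nm).
    by rewrite bE; case: (cycle_sign _).
  + apply: (admits_loops hn (t := 0) (ltnW k3)); first by rewrite addn0.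
    by rewrite [balance _]sb' addbb.
- move=> Cii; have nk0 : ~ admits_complete C k0.
    by apply: not_k0; case: Cii => [[] | []]; [right | left].
  split; first lia; last first.
    move=> j j1 ad; have := le_k0 j j1 ad; rewrite leq_eqVlt => /predU1P[jk|]; last lia.
    by rewrite jk in ad.
  have k0E := odd_double_half k0; case: Cii => [[nm sb'] | [nm ok nsb]].
    (* For odd $k_0$ one has $m_{k_0+1}=m_{k_0}+1=n$, against the maximality of $k_0$. *)
    have ok : ~~ odd k0.
      apply/negP => ok; move: k0E nm (hk0max k0.+1 isT); rewrite /m ok => <-.
      rewrite add1n num_edges_Kstar_odd -doubleS num_edges_Kstar_even.
      lia.
    move: k0E nm k3; rewrite /m (negbTE ok) add0n => <-.
    case: (k0./2) => // p; rewrite num_edges_Kstar_even doubleS subn1 /= => nm k3.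
    (* Here $k_0-1=2p+1$ and $n=(p+1)^2+1=m_{2p+1}+2$, just enough slack. *)
    apply: admits_slack; rewrite ?num_edges_Kstar_odd; lia.
  move: k0E nm k3 (sbP nsb); rewrite /m ok add1n => <-; set p := k0./2.
  rewrite num_edges_Kstar_odd subn1 /= => nm k3 bE.
  (* The slack over $K_{2p}^*$ is $2p\ge2$. For $p=1$ only the single loop of $K_2^*$ is available;
     walking it $n=3$ times gives a negative sign, which is that of the cycle since $K_3^*$ is
     even. *)
  case: (ltnP 1 p) => p1; first by apply: admits_slack; rewrite ?num_edges_Kstar_even; lia.
  have p1' : p = 1 by lia.
  rewrite p1' in nm bE *; apply: (admits_loops hn (t := 2) _) => //.
    by rewrite nm (num_edges_Kstar_even 1).
  have b3 : balance (Kstar 3) = false by rewrite balance_Kstar.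
  by move: bE; rewrite [balance _]b3 b2; case: (cycle_sign _).
move=> nCi nCii.
(* If $n=m+1$, one of the two balances falls under case (i) and the other under case (ii). *)
have nm : n = m.
  case: (ltngtP n m) hk0n => // lt_mn _.
  case: (ltngtP n (m + 1)) => h; first lia.
    by case: nCi; constructor 1; lia.
  by case: (eqVneq (balance (Kstar k0)) (cycle_sign sigma)) => [sb'|/eqP nsb];
    [case: nCii; left | case: nCi; constructor 2].
have nsb : ~ sb by move=> sb'; apply: nCi; constructor 3.
have ok : ~~ odd k0 by apply/negP => ok; apply: nCii; right.
have nk0 : ~ admits_complete C k0 by apply: not_k0; left.
have [p k0E] : exists p, k0 = p.+1.*2.
  by exists (k0./2).-1; have := odd_double_half k0; rewrite (negbTE ok); lia.
have bE := sbP nsb; subst k0; rewrite doubleS in k3.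
rewrite /m num_edges_Kstar_even in nm.
split; first lia; last first.
  move=> j j1 ad; have := le_k0 j j1 ad; rewrite leq_eqVlt => /predU1P[jk|].
    by rewrite jk in ad.
  rewrite doubleS ltnS leq_eqVlt => /predU1P[jk|]; last lia.
  (* The value $k_0-1=2p+1$ fails as well: $n=m_{2p+1}+1$ forces the cycle to differ in balance from
     $K_{2p+1}^*$, hence to agree with $K_{k_0}^*$, contrary to [bE]. *)
  rewrite jk in ad; have := admits_tight_succ ad; rewrite num_edges_Kstar_odd.
  move: bE; rewrite balance_Kstar_even_pred => bE; rewrite -bE.
  by move=> H; have : n = p * p + p.*2 + 1 by [lia]; move/H; case: (balance _).
(* The slack over $K_{2p}^*$ is $2p+1$. For $p=1$ the loop of $K_2^*$ is walked $n=4$ times, with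
   positive sign; the cycle is even because $K_4^*$ is odd. *)
rewrite doubleS subn2 /=; case: (ltnP 1 p) => p1.
  by apply: admits_slack; rewrite ?num_edges_Kstar_even; lia.
have p1' : p = 1 by lia.
rewrite p1' in nm bE *; apply: (admits_loops hn (t := 3) _) => //.
  by rewrite nm (num_edges_Kstar_even 1).
have b4 : balance (Kstar 4) = true by rewrite balance_Kstar.
by move: bE; rewrite [balance _]b4 b2; case: (cycle_sign _).
Qed.
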